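(* Let $s\ge 1$ and $r_1,\dots,r_s\ge 1$ be integers. Then there exist a constant $k$ (depending only on $r_1,\dots,r_s$) and a sequence of $P_{s+1}$-free families $\mathcal{F}_n\subseteq 2^{[n]}$, each of which is a union of full levels of $2^{[n]}$, such that $$La(n,P_{s+1},K_{r_1,r_2,\dots,r_s})=O\left(n^k\,c(K_{r_1,r_2,\dots,r_s},\mathcal{F}_n)\right).$$
   Context: $[n]=\{1,\dots,n\}$, $2^{[n]}$ is the family of all subsets of $[n]$; the full levels of $2^{[n]}$ are the families $\binom{[n]}{k}$ of all $k$-element subsets of $[n]$. For a finite poset $P$ and a family $\mathcal{F}$ of sets, a subfamily $\mathcal{G}\subseteq\mathcal{F}$ is a copy of $P$ in $\mathcal{F}$ if there is a bijection $\phi:P\to\mathcal{G}$ such that $x\le_Px'$ implies $\phi(x)\subseteq\phi(x')$ (the converse is not required). $c(P,\mathcal{F})$ is the number of copies of $P$ in $\mathcal{F}$; $\mathcal{F}$ is $P$-free if $c(P,\mathcal{F})=0$. $La(n,P,Q)=\max\{c(Q,\mathcal{F}):\mathcal{F}\subseteq 2^{[n]},\ c(P,\mathcal{F})=0\}$. $P_k$ is the chain on $k$ elements. The complete multi-level poset $K_{r_1,\dots,r_s}$ has $\sum_{i=1}^sr_i$ elements $a^i_h$ ($1\le i\le s$, $1\le h\le r_i$) with $a^i_h<a^j_l$ if and only if $i<j$. *)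

(* Defs.v *)
From HB Require Import structures.
From mathcomp Require Import all_boot all_order all_algebra.
From mathcomp Require Import boolp reals topology normedtype landau sequences.

Set Implicit Arguments.
Unset Strict Implicit.
Unset Printing Implicit Defensive.

Import Order.TTheory.

Export numFieldNormedType.Exports.

(* Ground set: 'I_n plays the role of [n], so a family F of subsets of [n] has
   type {set {set 'I_n}}. *)

Section Copies.
Local Open Scope order_scope.

(* Only the forward implication is required of phi ("weak" copy). *)
Definition is_copy (d : Order.disp_t) (P : finPOrderType d) (n : nat)
    (G : {set {set 'I_n}}) : bool :=
  [exists phi : {ffun P -> {set 'I_n}},
    [&& injectiveb phi, phi @: [set: P] == G
      & [forall x, forall y, (x <= y) ==> (phi x \subset phi y)]]].

(* Copies are counted as subfamilies, not as embeddings. *)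
Definition ncopies (d : Order.disp_t) (P : finPOrderType d) (n : nat)
    (F : {set {set 'I_n}}) : nat :=
  #|[set G : {set {set 'I_n}} | (G \subset F) && is_copy P G]|.

End Copies.

Definition poset_free (d : Order.disp_t) (P : finPOrderType d) (n : nat)
    (F : {set {set 'I_n}}) : bool :=
  ncopies P F == 0.

Definition La (n : nat) (d d' : Order.disp_t)
    (P : finPOrderType d) (Q : finPOrderType d') : nat :=
  \max_(F : {set {set 'I_n}} | poset_free P F) ncopies Q F.

Definition level (n k : nat) : {set {set 'I_n}} :=
  [set A : {set 'I_n} | #|A| == k].

Definition union_of_levels (n : nat) (F : {set {set 'I_n}}) : Prop :=
  exists D : {set 'I_n.+1}, F = \bigcup_(k in D) level n k.

Section Multilevel.
Variables (s : nat) (r : 'I_s -> nat).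

(* An alias, so that the order below does not clash with the lexicographic
   orders existing on sigma types; a^i_h is Tagged _ h with tag i. *)
Definition multilevel : Type := {i : 'I_s & 'I_(r i)}.

HB.instance Definition _ := Finite.on multilevel.

Definition multilevel_lt (x y : multilevel) : bool := (tag x < tag y)%N.

Fact multilevel_lt_irr : irreflexive multilevel_lt.
Proof. by move=> x; rewrite /multilevel_lt ltnn. Qed.

Fact multilevel_lt_trans : transitive multilevel_lt.
Proof. by move=> y x z; apply: ltn_trans. Qed.

Fact multilevel_display : Order.disp_t.
Proof. exact: (Order.Disp tt tt). Qed.

HB.instance Definition _ :=
  Order.Lt_isPOrder.Build multilevel_display multilevel
    multilevel_lt_irr multilevel_lt_trans.

End Multilevel.

(* Main.v *)
(* Let q be the number of up-sets of the poset K.  A monotone map from K to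
   2^[n] is the choice, for each point of [n], of an up-set of K (its column);
   so no family at all contains more than q^n copies of K, and it suffices to
   find s levels with at least q^n / n^O(1) copies.  Let each up-set be the
   column of exactly m = floor(n / q) points.  Then x is mapped to a set of size
   m times the number of up-sets containing x, which depends only on the level
   of x in K, and the map is injective as soon as m > 0.  Such balanced columns
   are a polynomial fraction of all of them: cut q m points into q blocks of
   size m, use in every block words of one most popular letter profile, and
   shift the alphabet cyclically from block to block. *)
Require Import Defs.
From mathcomp Require Import all_boot all_order all_algebra.
From mathcomp Require Import fingroup perm.

Set Implicit Arguments.
Unset Strict Implicit.
Unset Printing Implicit Defensive.

Import Order.TTheory.

(** * Counting by fibers *)

Section Pigeonhole.
Local Open Scope nat_scope.

Lemma leq_card_fibers (T U : finType) (f : T -> U) (C : {set U}) (A : {set T}) b :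
    (forall x, x \in A -> f x \in C) ->
    (forall u, u \in C -> #|[set x in A | f x == u]| <= b) ->
  #|A| <= #|C| * b.
Proof.
move=> fAC fb; rewrite -sum1_card (partition_big f (mem C)) //= -sum_nat_const.
apply: leq_sum => u uC; apply: leq_trans (fb u uC).
by rewrite -sum1_card; apply/eq_leq/eq_bigl => x; rewrite !inE.
Qed.

Lemma popular_fiber (T U : finType) (f : T -> U) (u0 : U) :
  exists u, #|T| <= #|U| * #|[set x | f x == u]|.
Proof.
have [u _ umax] := arg_maxnP (fun u => #|[set x | f x == u]|) (erefl : xpredT u0).
exists u; rewrite -(cardsT T) -(cardsT U).
apply: (leq_card_fibers (f := f)) => [x _|v _]; first exact: in_setT.
by apply: leq_trans (umax v isT); apply/eq_leq/eq_card => x; rewrite !inE.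
Qed.

End Pigeonhole.

(** * Words in which every letter occurs equally often *)

Section BalancedWords.
Local Open Scope nat_scope.
Variables p m : nat.
Notation q := p.+1.

Definition balanced : {set {ffun 'I_q * 'I_m -> 'I_q}} :=
  [set f : {ffun 'I_q * 'I_m -> 'I_q} | [forall u, #|f @^-1: [set u]| == m]].

(** Counts are stored in ['I_m.+1], so that there are only [m.+1 ^ q] profiles for the
    pigeonhole. *)
Definition profile (w : {ffun 'I_m -> 'I_q}) : {ffun 'I_q -> 'I_m.+1} :=
  [ffun u => inord #|w @^-1: [set u]|].

Lemma profileE w u : profile w u = #|w @^-1: [set u]| :> nat.
Proof. by rewrite ffunE inordK // ltnS -[X in _ <= X]card_ord max_card. Qed.

Lemma sum_profile w : \sum_u profile w u = m.
Proof.
rewrite -[RHS](card_ord m) -[RHS]sum1_card (partition_big w xpredT) //=.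
apply: eq_bigr => u _; rewrite profileE -sum1_card.
by apply: eq_bigl => j; rewrite !inE.
Qed.

Definition shift_words (W : {ffun 'I_q -> {ffun 'I_m -> 'I_q}}) :
    {ffun 'I_q * 'I_m -> 'I_q} := [ffun z => (W z.1 z.2 + z.1)%R].

Lemma shift_words_inj : injective shift_words.
Proof.
move=> W W' /ffunP eqW; apply/ffunP => c; apply/ffunP => j.
by have := eqW (c, j); rewrite !ffunE /=; apply: GRing.addIr.
Qed.

(* Summing the fiber of [u] over the cyclic shifts runs once through every
   entry of the common profile, whatever [u] is. *)
Lemma shift_words_balanced (W : {ffun 'I_q -> {ffun 'I_m -> 'I_q}}) P :
  (forall c, profile (W c) = P) -> shift_words W \in balanced.
Proof.
move=> WP; rewrite inE; apply/forallP => u; apply/eqP.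
have -> : #|shift_words W @^-1: [set u]| = \sum_c P (u - c)%R.
  rewrite -sum1_card (partition_big fst xpredT) //=; apply: eq_bigr => c _.
  rewrite -(WP c) profileE -(card_imset _ (_ : injective (pair c))); last first.
    by move=> i j [].
  rewrite -sum1_card; apply: eq_bigl => -[c' j]; rewrite !inE ffunE /=.
  apply/andP/imsetP => [[/eqP <- /eqP ->]|[k]]; last first.
    by rewrite !inE => /eqP Wk [-> ->]; rewrite Wk GRing.subrK !eqxx.
  by exists j; rewrite // !inE GRing.addrK.
have := sum_profile (W ord0); rewrite WP; apply: etrans.
rewrite [RHS](reindex_inj (h := fun c => (u - c)%R)) //.
by move=> c c' /GRing.addrI /GRing.oppr_inj.
Qed.

Lemma card_balanced : q ^ (q * m) <= m.+1 ^ (q * q) * #|balanced|.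
Proof.
have [P] := popular_fiber profile [ffun => ord0].
rewrite !card_ffun !card_ord => qP.
set S := [set w | _] in qP.
have cardS : #|S| ^ q <= #|balanced|.
  have := card_ffun_on 'I_q S; rewrite card_ord => <-.
  rewrite -(card_imset _ shift_words_inj).
  apply/subset_leq_card/subsetP => _ /imsetP[W /ffun_onP WS ->].
  by apply: (@shift_words_balanced _ P) => c; have := WS c; rewrite inE => /eqP.
(* The pigeonhole bound [qP] for one block is raised to the power [q], the number of blocks. *)
rewrite mulnC !expnM; apply: leq_trans (leq_mul (leqnn _) cardS).
by rewrite -expnMn leq_exp2r.
Qed.

End BalancedWords.

(** * Up-sets, monotone maps and copies of a finite poset *)

Section Upsets.
Local Open Scope nat_scope.
Variables (d : Order.disp_t) (P : finPOrderType d).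

Definition upsets : {set {set P}} :=
  [set U : {set P} | [forall x, forall y, (x <= y)%O ==> (x \in U) ==> (y \in U)]].

Lemma upsetP (U : {set P}) :
  reflect (forall x y, (x <= y)%O -> x \in U -> y \in U) (U \in upsets).
Proof.
rewrite inE; apply: (iffP forallP) => [UP x y xy|UP x].
  by move/forallP/(_ y)/implyP/(_ xy)/implyP: (UP x).
by apply/forallP => y; apply/implyP => xy; apply/implyP; apply: UP.
Qed.

Definition up (x : P) : {set P} := [set y | (x <= y)%O].

Lemma up_upset x : up x \in upsets.
Proof. by apply/upsetP => y z yz; rewrite !inE => /le_trans; apply. Qed.

Lemma card_upsets_gt0 : 0 < #|upsets|.
Proof. by apply/card_gt0P; exists set0; apply/upsetP => x y; rewrite !inE. Qed.

Section Maps.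
Variable n : nat.
Implicit Types (phi : {ffun P -> {set 'I_n}}) (F : {set {set 'I_n}}).

Definition monotone phi :=
  [forall x, forall y, (x <= y)%O ==> (phi x \subset phi y)].

Lemma monotoneP phi :
  reflect (forall x y, (x <= y)%O -> phi x \subset phi y) (monotone phi).
Proof.
apply: (iffP forallP) => [mon x y xy|mon x].
  by move/forallP/(_ y)/implyP/(_ xy): (mon x).
by apply/forallP => y; apply/implyP; apply: mon.
Qed.

Lemma card_monotone : #|[set phi | monotone phi]| <= #|upsets| ^ n.
Proof.
pose col phi : {ffun 'I_n -> {set P}} := [ffun i => [set x | i \in phi x]].
have col_inj : injective col.
  move=> phi psi /ffunP eqc; apply/ffunP => x; apply/setP => i.
  by have /setP/(_ x) := eqc i; rewrite !ffunE !inE.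
have := card_ffun_on 'I_n upsets; rewrite card_ord => <-.
rewrite -(card_imset _ col_inj).
apply/subset_leq_card/subsetP => _ /imsetP[phi + ->]; rewrite inE => /monotoneP mon.
apply/ffun_onP => i; apply/upsetP => x y /mon/subsetP sub.
by rewrite ffunE !inE; apply: sub.
Qed.

Lemma ncopies_leq F : ncopies P F <= #|upsets| ^ n.
Proof.
apply: leq_trans card_monotone.
apply: leq_trans (leq_imset_card (fun phi => phi @: [set: P]) _).
apply/subset_leq_card/subsetP => G; rewrite inE => /andP[_ /existsP[phi]].
by case/and3P => _ /eqP <- mon; apply: imset_f; rewrite inE.
Qed.

(** A copy [G] has [#|P|] members, so at most [#|P| ^ #|P|] maps have it as their image. *)
Lemma ncopies_geq F (S : {set {ffun P -> {set 'I_n}}}) :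
    (forall phi, phi \in S ->
       [/\ injective phi, monotone phi & forall x, phi x \in F]) ->
  #|S| <= ncopies P F * #|P| ^ #|P|.
Proof.
move=> SF; apply: (leq_card_fibers (f := fun phi => phi @: [set: P])).
  move=> phi /SF[inj mon phiF]; rewrite inE; apply/andP; split.
    by apply/subsetP => _ /imsetP[x _ ->]; apply: phiF.
  by apply/existsP; exists phi; apply/and3P; split=> //; apply/injectiveP.
move=> G; rewrite inE => /andP[_ /existsP[phi0 /and3P[/injectiveP inj0 /eqP eG _]]].
have := card_ffun_on P G; rewrite -{2}eG card_imset // cardsT => <-.
apply/subset_leq_card/subsetP => phi; rewrite inE => /andP[_ /eqP <-].
by apply/ffun_onP => x; apply: imset_f.
Qed.

End Maps.

(** Up to the factor [m], the size of the image of [x] under a map with balanced columns. *)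
Definition upset_degree (x : P) : nat := #|[set U in upsets | x \in U]|.

(** Taking images under [g] permutes the up-sets and carries those containing [x] onto those
    containing [g x]. *)
Lemma upset_degree_automorphism (g : {perm P}) x :
  (forall y z, (g y <= g z)%O = (y <= z)%O) -> upset_degree (g x) = upset_degree x.
Proof.
move=> gmon; rewrite /upset_degree -[RHS](card_imset _ (imset_inj (@perm_inj _ g))).
apply/eq_card => U; rewrite in_set; apply/andP/imsetP => [[/upsetP UP gxU]|].
  exists (g @^-1: U); last first.
    apply/setP => y; apply/idP/imsetP => [yU|[z]]; last by rewrite inE => ? ->.
    by exists (g^-1%g y); rewrite ?inE permKV.
  rewrite in_set; apply/andP; split; last by rewrite inE.
  by apply/upsetP => y z yz; rewrite !inE; apply: UP; rewrite gmon.
case=> V; rewrite in_set => /andP[/upsetP VP xV] ->; split; last exact: imset_f.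
apply/upsetP => _ z /[swap] /imsetP[y yV ->] gyz.
rewrite -(permKV g z); apply: imset_f; apply: VP yV.
by rewrite -gmon permKV.
Qed.

Section Pattern.
Variables (p m n : nat) (pat : 'I_p.+1 -> {set P}).
Hypotheses (pat_inj : injective pat) (pat_upsets : pat @: [set: _] = upsets).
Hypothesis qm_leq : p.+1 * m <= n.

Let card_cells : #|{: 'I_p.+1 * 'I_m}| <= n.
Proof. by rewrite card_prod !card_ord. Qed.

Definition cell (z : 'I_p.+1 * 'I_m) : 'I_n := widen_ord card_cells (enum_rank z).

Lemma cell_inj : injective cell.
Proof.
by move=> z z' /(congr1 val) /= /ord_inj /enum_rank_inj.
Qed.

(** The letter at a cell names the up-set that is its column; the points of ['I_n] that are not
    cells get the empty column. *)
Definition map_of_word (f : {ffun 'I_p.+1 * 'I_m -> 'I_p.+1}) :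
    {ffun P -> {set 'I_n}} := [ffun x => cell @: [set z | x \in pat (f z)]].

Lemma mem_map_of_word f x z : (cell z \in map_of_word f x) = (x \in pat (f z)).
Proof. by rewrite ffunE mem_imset ?inE //; apply: cell_inj. Qed.

Lemma pat_upset u : pat u \in upsets.
Proof. by rewrite -pat_upsets imset_f. Qed.

Lemma map_of_word_monotone f : monotone (map_of_word f).
Proof.
apply/monotoneP => x y xy; rewrite !ffunE; apply/imsetS/subsetP => z.
by rewrite !inE; apply: (upsetP _ (pat_upset (f z))).
Qed.

Lemma map_of_word_inj : injective map_of_word.
Proof.
move=> f g eqfg; apply/ffunP => z; apply/pat_inj/setP => x.
by rewrite -!mem_map_of_word eqfg.
Qed.

Lemma card_map_of_word f x :
  f \in balanced p m -> #|map_of_word f x| = m * upset_degree x.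
Proof.
rewrite inE => /forallP bal; rewrite ffunE card_imset; last exact: cell_inj.
have -> : upset_degree x = #|[set u | x \in pat u]|.
  rewrite -(card_imset _ pat_inj) /upset_degree -pat_upsets; apply: eq_card => U.
  rewrite in_set; apply/andP/imsetP => [[/imsetP[u _ ->] xu]|[u]].
    by exists u; rewrite // inE.
  by rewrite inE => xu ->; rewrite imset_f.
(* The cells are sorted by their letter: each letter whose up-set contains [x] contributes [m] of
   them. *)
rewrite mulnC -sum_nat_const -sum1_card (partition_big f [in [set u | x \in pat u]]).
  apply: eq_bigr => u; rewrite inE => xu.
  apply: etrans (eqP (bal u)); rewrite -sum1_card; apply: eq_bigl => z; rewrite !inE.
  by apply: andb_idl => /eqP ->.
by move=> z; rewrite !inE.
Qed.

(** As [m > 0], the up-set [up a] is the column of some cell. If [a] and [b] have the same image,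
    that cell puts [b] in [up a]; antisymmetry concludes. *)
Lemma map_of_word_injective f :
  0 < m -> f \in balanced p m -> injective (map_of_word f).
Proof.
rewrite inE => m_gt0 /forallP bal x y eqxy.
have le_xy a b : map_of_word f a = map_of_word f b -> (a <= b)%O.
  move=> eqab; have := up_upset a; rewrite -pat_upsets => /imsetP[u _ upa].
  have: 0 < #|f @^-1: [set u]| by rewrite (eqP (bal u)).
  case/card_gt0P => z; rewrite !inE => /eqP fz.
  have := mem_map_of_word f b z; rewrite -eqab mem_map_of_word fz -upa !inE lexx.
  by move=> /esym.
by apply/eqP; rewrite eq_le !le_xy.
Qed.

End Pattern.

Definition degree_levels (m n : nat) : {set {set 'I_n}} :=
  \bigcup_(k in [set k : 'I_n.+1 |
                   [exists x : P, k == m * upset_degree x :> nat]]) level n k.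

Lemma mem_level_set n (D : {set 'I_n.+1}) A :
  (A \in \bigcup_(k in D) level n k) = (inord #|A| \in D).
Proof.
have An : #|A| < n.+1 by rewrite ltnS -[X in _ <= X]card_ord max_card.
apply/bigcupP/idP => [[k kD]|AD].
  by rewrite inE => /eqP ->; rewrite inord_val.
by exists (inord #|A|); rewrite // inE inordK.
Qed.

(** The three losses: [q ^ q] for the fewer than [q] points outside the blocks, [#|P| ^ #|P|] for
    maps with the same image, and the power of [n.+1] for fixing a profile. *)
Lemma card_upsets_exp n : let q := #|upsets| in q <= n ->
  q ^ n <= q ^ q * #|P| ^ #|P| * (n.+1 ^ (q * q) *
             ncopies P (degree_levels (n %/ q) n)).
Proof.
move=> q qn; have q_gt0 : 0 < q := card_upsets_gt0.
(* The cyclic addition on letters lives on ['I_p.+1]. *)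
have [p Ep] : {p | q = p.+1} by exists q.-1; rewrite prednK.
set m := n %/ q; have m_gt0 : 0 < m by rewrite divn_gt0.
have qmn : p.+1 * m <= n by rewrite -Ep mulnC leq_divM.
pose pat (u : 'I_p.+1) : {set P} := enum_val (cast_ord (esym Ep) u).
have pat_inj : injective pat by move=> u v /enum_val_inj/cast_ord_inj.
have pat_up : pat @: [set: _] = upsets.
  apply/setP => U; apply/imsetP/idP => [[u _ ->]|UP]; first exact: enum_valP.
  exists (cast_ord Ep (enum_rank_in UP U)); rewrite // /pat cast_ordK.
  by rewrite enum_rankK_in.
have lower : #|balanced p m| <= ncopies P (degree_levels m n) * #|P| ^ #|P|.
  rewrite -(card_imset _ (map_of_word_inj (qm_leq := qmn) pat_inj)).
  apply: ncopies_geq => _ /imsetP[f fb ->].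
  split; [exact: map_of_word_injective fb|exact: map_of_word_monotone|move=> x].
  rewrite mem_level_set inE; apply/existsP; exists x; apply/eqP.
  by rewrite inordK ?card_map_of_word // -(card_map_of_word pat_inj _ qmn x fb)
    // ltnS -[X in _ <= X]card_ord max_card.
have qnE : q ^ n <= q ^ q * q ^ (q * m).
  rewrite -expnD leq_pexp2l // {1}(divn_eq n q) addnC mulnC leq_add2r.
  by rewrite ltnW ?ltn_pmod.
have qmE : q ^ (q * m) <=
    n.+1 ^ (q * q) * (ncopies P (degree_levels m n) * #|P| ^ #|P|).
  rewrite Ep; apply: leq_trans (card_balanced p m) _.
  by rewrite leq_mul // leq_exp2r ?muln_gt0 // ltnS leq_div.
apply: leq_trans qnE _; rewrite -mulnA leq_mul2l mulnCA (mulnC _ (ncopies _ _)).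
by rewrite qmE orbT.
Qed.

End Upsets.

(** * Chain-free unions of levels and the symmetry of the multi-level poset *)

Section Levels.
Local Open Scope nat_scope.

(** Sizes strictly increase along a chain of distinct sets, so a chain of [s.+1] sets meets [s.+1]
    levels. *)
Lemma level_union_chain_free n s (D : {set 'I_n.+1}) :
  #|D| <= s -> poset_free 'I_s.+1 (\bigcup_(k in D) level n k).
Proof.
move=> Ds; rewrite /poset_free cards_eq0; apply/eqP/setP => G; rewrite !inE.
apply/negP => /andP[/subsetP GF /existsP[phi /and3P[/injectiveP inj /eqP eG mon]]].
have phi_sub (i j : 'I_s.+1) : (i <= j)%O -> phi i \subset phi j.
  exact: (elimT (monotoneP _) mon).
have size_inj : injective (fun i => inord #|phi i| : 'I_n.+1).
  have phi_n i : #|phi i| < n.+1 by rewrite ltnS -[X in _ <= X]card_ord max_card.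
  have le_inj (i j : 'I_s.+1) : (i <= j)%O -> #|phi i| = #|phi j| -> i = j.
    move=> /phi_sub sub eqc; apply/inj/eqP.
    by rewrite eqEcard sub eqc leqnn.
  move=> i j /(congr1 val); rewrite /= !inordK // => eqc.
  by case: (leP i j) => [|/ltW] /le_inj ->.
have: #|[set: 'I_s.+1]| <= #|D|.
  rewrite -(card_imset _ size_inj); apply/subset_leq_card/subsetP => _ /imsetP[i _ ->].
  by rewrite -mem_level_set GF // -eG imset_f.
by rewrite cardsT card_ord leqNgt ltnS Ds.
Qed.

Variables (s : nat) (r : 'I_s -> nat).
Notation K := (multilevel r).

Lemma multilevel_le (x y : K) : (x <= y)%O = (x == y) || (tag x < tag y).
Proof. by rewrite le_eqVlt. Qed.

(** The transposition of [x] and [y] preserves tags, hence is an automorphism of [K]. *)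
Lemma upset_degree_tag (x y : K) : tag x = tag y -> upset_degree x = upset_degree y.
Proof.
move=> xy; have tag_tperm z : tag (tperm x y z) = tag z by case: tpermP => // ->.
rewrite -(tpermL x y); apply/esym/upset_degree_automorphism => u v.
by rewrite !multilevel_le !tag_tperm (inj_eq perm_inj).
Qed.

Lemma card_degree_set m n :
  #|[set k : 'I_n.+1 | [exists x : K, k == m * upset_degree x :> nat]]| <= s.
Proof.
rewrite -[X in _ <= X]card_ord.
(* Any element with tag [i] gives the same size; [ord0] is the default for a tag without
   elements. *)
pose size_at (i : 'I_s) : 'I_n.+1 :=
  if [pick x : K | tag x == i] is Some x then inord (m * upset_degree x) else ord0.
rewrite -cardsT; apply: leq_trans (leq_imset_card size_at _).
apply/subset_leq_card/subsetP => k; rewrite inE => /existsP[x /eqP kx].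
apply/imsetP; exists (tag x); rewrite // /size_at.
case: pickP => [y /eqP/upset_degree_tag ->|/(_ x)]; last by rewrite eqxx.
by rewrite -kx inord_val.
Qed.

End Levels.

(* The asymptotic comparison *)
From mathcomp Require Import boolp classical_sets reals topology normedtype landau sequences.

Local Open Scope classical_set_scope.
Local Open Scope ring_scope.

Theorem corollary1p11 (s : nat) (r : 'I_s -> nat)
    (hs : (1 <= s)%N) (hr : forall i : 'I_s, (1 <= r i)%N) :
  exists (k : nat) (F : forall n : nat, {set {set 'I_n}}),
    (forall n : nat, poset_free 'I_s.+1 (F n) /\ union_of_levels (F n)) /\
    (forall R : realType,
      (fun n : nat => (La n 'I_s.+1 (multilevel r))%:R : R^o)
      =O_\oo (fun n : nat => (n ^ k * ncopies (multilevel r) (F n))%:R : R^o)).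
Proof.
set q := #|upsets (multilevel r)|.
exists (q * q)%N, (fun n => degree_levels (multilevel r) (n %/ q) n); split=> [n|R].
  by split; [exact/level_union_chain_free/card_degree_set|eexists].
set N := (#|{: multilevel r}| ^ #|{: multilevel r}|)%N.
(* The power of 2 comes from [n.+1 <= 2 * n], valid once [n >= q > 0]; it turns [n.+1 ^ (q * q)]
   into [n ^ (q * q)]. Below, [C.+1] makes the constant visibly positive. *)
set C := (q ^ q * N * 2 ^ (q * q))%N.
apply/eqO_exP; exists C.+1%:R => //.
have q_gt0 : (0 < q)%N := card_upsets_gt0 _.
near=> n; have qn : (q <= n)%N by near: n; exact: nbhs_infty_ge.
rewrite !Num.Theory.normr_nat -GRing.natrM Num.Theory.ler_nat.
have Laq : (La n 'I_s.+1 (multilevel r) <= q ^ n)%N.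
  by apply/bigmax_leqP => F _; apply: ncopies_leq.
apply: leq_trans Laq (leq_trans (card_upsets_exp qn) _).
rewrite mulSn -[X in (X <= _)%N]add0n leq_add // /C -!mulnA !leq_mul2l mulnA.
rewrite leq_mul2r -expnMn leq_exp2r ?muln_gt0 ?q_gt0 // mul2n -addnn -addn1.
by rewrite leq_add2l (leq_trans q_gt0 qn) !orbT.
Unshelve. all: by end_near.
Qed.
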